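(* Let $m\ge 2$ and $1\le\ell\le m$, and let $F=(f_1,\dots,f_\ell)$ be a bent vectorial function from $\mathrm{GF}(2^{2m})$ to $\mathrm{GF}(2)^\ell$. Let $\mathcal{C}=\mathcal{C}(f_1,\dots,f_\ell)$, a binary linear $[2^{2m},2m+1+\ell,2^{2m-1}-2^{m-1}]$ code. Then: (a) the supports of the codewords of $\mathcal{C}$ of minimum weight $2^{2m-1}-2^{m-1}$ form a $2$-design with parameters $2$-$(2^{2m},\,2^{2m-1}-2^{m-1},\,(2^\ell-1)(2^{2m-2}-2^{m-1}))$; (b) the supports of the codewords of $\mathcal{C}$ of weight $2^{2m-1}+2^{m-1}$ form a $2$-design with parameters $2$-$(2^{2m},\,2^{2m-1}+2^{m-1},\,(2^\ell-1)(2^{2m-2}+2^{m-1}))$.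
   Context: Write $\mathrm{GF}(2^{2m})=\{u_1,\dots,u_q\}$, $q=2^{2m}$, and let $\mathrm{tr}_{2m/1}$ be the absolute trace to $\mathrm{GF}(2)$. A Boolean function $f:\mathrm{GF}(2^{2m})\to\mathrm{GF}(2)$ is bent if $\left|\sum_{x}(-1)^{f(x)+\mathrm{tr}_{2m/1}(wx)}\right|=2^m$ for all $w$. $F=(f_1,\dots,f_\ell)$ is a bent vectorial function if $\sum_j a_jf_j$ is bent for every nonzero $(a_1,\dots,a_\ell)\in\mathrm{GF}(2)^\ell$. The truth table of $f$ is $(f(u_1),\dots,f(u_q))$. $\mathrm{RM}_2(1,2m)=\{(\mathrm{tr}_{2m/1}(bu_i)+c)_{i=1}^q:b\in\mathrm{GF}(2^{2m}),c\in\mathrm{GF}(2)\}$, and $\mathcal{C}(f_1,\dots,f_\ell)$ is the binary linear code spanned by $\mathrm{RM}_2(1,2m)$ and the truth tables of $f_1,\dots,f_\ell$. The support of a codeword is the set of coordinate positions (points $u_1,\dots,u_q$) where it is nonzero. A $2$-$(v,k,\lambda)$ design is a set of $v$ points with a collection of $k$-subsets (blocks) such that every $2$-subset of points lies in exactly $\lambda$ blocks. *)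

(* Defs.v *)
From mathcomp Require Import all_boot all_order all_algebra finfield.

Set Implicit Arguments.
Unset Strict Implicit.
Unset Printing Implicit Defensive.

Import Order.TTheory GRing.Theory Num.Theory.
Local Open Scope ring_scope.

Definition frob_trace (K : finFieldType) (n : nat) (x : K) : K :=
  \sum_(i < n) x ^+ (2 ^ i).

(* When #|K| = 2 ^ n, frob_trace lies in the prime subfield {0, 1} of K;
   abs_trace is its value read in 'F_2, see abs_traceE below. *)
Definition abs_trace (K : finFieldType) (n : nat) (x : K) : 'F_2 :=
  (frob_trace n x != 0)%:R.

Lemma abs_traceE (K : finFieldType) (n : nat) (x : K) :
  #|K| = (2 ^ n)%N -> (abs_trace n x : nat)%:R = frob_trace n x.
Proof.
move=> cardK.
have ch2 : 2 \in [pchar K] by apply: (card_finPcharP cardK).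
have sq : frob_trace n x ^+ 2 = frob_trace n x.
  rewrite /frob_trace -(pFrobenius_autE ch2) rmorph_sum /=.
  under eq_bigr => i _ do rewrite pFrobenius_autE -exprM -expnSr.
  case: n cardK => [|n] cardK; first by rewrite !big_ord0.
  by rewrite big_ord_recr big_ord_recl /= -cardK expf_card expr1 addrC.
rewrite /abs_trace; case: eqVneq => [-> //|nz].
by apply: (mulfI nz); rewrite mulr1 -expr2 sq.
Qed.

Section Bent.
Variables (K : finFieldType) (m : nat).

Definition walsh (f : K -> 'F_2) (w : K) : int :=
  \sum_(x : K) (-1) ^+ nat_of_ord (f x + abs_trace (2 * m) (w * x))%R.

Definition bent (f : K -> 'F_2) : Prop :=
  forall w : K, `|walsh f w| = (2 ^ m)%N%:Z.

Definition coordinate (l : nat) (F : K -> 'rV['F_2]_l) (j : 'I_l) : K -> 'F_2 :=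
  fun x => F x 0 j.

Definition bent_vectorial (l : nat) (F : K -> 'rV['F_2]_l) : Prop :=
  forall a : 'rV['F_2]_l, a != 0 ->
    bent (fun x => \sum_(j < l) a 0 j * coordinate F j x).

End Bent.

Section Codes.
Variable n : nat.

Definition csupp (c : 'rV['F_2]_n) : {set 'I_n} := [set i | c 0 i != 0].

Definition hamming_wt (c : 'rV['F_2]_n) : nat := #|csupp c|.

Definition hamming_dist (c c' : 'rV['F_2]_n) : nat :=
  #|[set i | c 0 i != c' 0 i]|.

Definition is_linear_code (k d : nat) (C : {vspace 'rV['F_2]_n}) : Prop :=
  [/\ \dim C = k,
      (exists c c', [/\ c \in C, c' \in C, c != c' & hamming_dist c c' = d])
    & (forall c c', c \in C -> c' \in C -> c != c' ->
         (d <= hamming_dist c c')%N)].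

Definition supports_of_weight (C : {vspace 'rV['F_2]_n}) (k : nat) :
  {set {set 'I_n}} :=
  [set csupp c | c : 'rV['F_2]_n & (c \in C) && (hamming_wt c == k)].

End Codes.

Section BentCode.
Variables (K : finFieldType) (m : nat) (u : 'I_(2 ^ (2 * m)) -> K).

Definition truth_table (f : K -> 'F_2) : 'rV['F_2]_(2 ^ (2 * m)) :=
  \row_i f (u i).

Definition RM1 : {set 'rV['F_2]_(2 ^ (2 * m))} :=
  [set \row_i (abs_trace (2 * m) (b * u i) + c) | b : K, c : 'F_2].

Definition bent_code (l : nat) (F : K -> 'rV['F_2]_l) :
  {vspace 'rV['F_2]_(2 ^ (2 * m))} :=
  <<enum RM1 ++ [seq truth_table (coordinate F j) | j <- enum 'I_l]>>%VS.

End BentCode.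

Definition is_2design (T : finType) (v k lambda : nat) (B : {set {set T}}) : Prop :=
  [/\ #|T| = v,
      (forall b, b \in B -> #|b| = k)
    & (forall P : {set T}, #|P| = 2%N ->
         #|[set b in B | P \subset b]| = lambda)].

(* Main.v *)
Require Import Defs.
From mathcomp Require Import all_boot all_order all_algebra.
From mathcomp Require Import finfield zify ring.

Set Implicit Arguments.
Unset Strict Implicit.
Unset Printing Implicit Defensive.

Import Order.TTheory GRing.Theory Num.Theory.

(** Every codeword is [x |-> a.F(x) + tr(bx) + c] for a unique triple
    [(a, b, c)], and twice its weight is [2^(2m) - (-1)^c W_a(b)], with [W_a]
    the Walsh transform of [a.F].  For [a = 0] the weight is [0], [2^(2m-1)] or
    [2^(2m)]; for [a <> 0] it is [2^(2m-1) -+ 2^(m-1)], and each pair [(a, b)]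
    gives each sign for exactly one [c].  For fixed [a <> 0] and distinct
    points [x], [y], the number of [b] whose block contains both is a quarter of
    a sum of products of [+1/-1] functions of [b]; Fourier inversion evaluates
    the single terms and orthogonality kills the mixed one, so the count is
    independent of [a], [x] and [y]. *)

(** * Signs of bits and Hamming weight as a sum of signs *)

Section SignCharacter.
Local Open Scope ring_scope.

Definition sgnF2 (a : 'F_2) : int := (-1) ^+ nat_of_ord a.

Lemma F2_cases (a : 'F_2) : a = 0 \/ a = 1.
Proof. by case: a => [[|[|//]] ?]; [left|right]; apply/val_inj. Qed.

Lemma sgnF2D (a b : 'F_2) : sgnF2 (a + b) = sgnF2 a * sgnF2 b.
Proof. by case: (F2_cases a) => ->; case: (F2_cases b) => ->. Qed.

Lemma sgnF2_sqr (a : 'F_2) : sgnF2 a * sgnF2 a = 1.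
Proof. by case: (F2_cases a) => ->. Qed.

Lemma natr_neq0_sgnF2 (a : 'F_2) : (a != 0%R)%:R * 2 = 1 - sgnF2 a :> int.
Proof. by case: (F2_cases a) => ->. Qed.

Lemma sum_F2 (f : 'F_2 -> int) : \sum_(c : 'F_2) f c = f 0 + f 1.
Proof.
rewrite (bigD1 0) //= (bigD1 1) //= big1 ?addr0 // => i.
by case: (F2_cases i) => ->.
Qed.

(** Induction on a span; it will put every word of the code into parametrised form. *)
Lemma span_closed_mem (R : fieldType) (V : vectType R) (P : V -> Prop)
    (s : seq V) :
  P 0 -> (forall v w, P v -> P w -> P (v + w)) ->
  (forall k v, P v -> P (k *: v)) -> (forall v, v \in s -> P v) ->
  forall v, v \in <<s>>%VS -> P v.
Proof.
move=> P0 PD PZ Ps v vs; rewrite (coord_span (X := in_tuple s) vs).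
by apply: big_ind => // i _; apply/PZ/Ps/mem_nth.
Qed.

Lemma csupp_inj n : injective (@csupp n).
Proof.
move=> c d /setP cd; apply/rowP => i; move: (cd i); rewrite !inE.
by case: (F2_cases (c 0 i)) => ->; case: (F2_cases (d 0 i)) => ->.
Qed.

Lemma hamming_dist_wt n (c d : 'rV['F_2]_n) :
  hamming_dist c d = hamming_wt (c - d).
Proof. by apply: eq_card => i; rewrite !inE !mxE subr_eq0. Qed.

(** Each coordinate contributes [1 - sgnF2], twice its support indicator. *)
Lemma hamming_wt_sgn n (c : 'rV['F_2]_n) :
  (hamming_wt c)%:Z * 2 = n%:Z - \sum_i sgnF2 (c 0 i).
Proof.
rewrite /hamming_wt -sum1_card big_mkcond /= -natz natr_sum mulr_suml.
rewrite (eq_bigr (fun i => 1 - sgnF2 (c 0%R i))).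
  by rewrite sumrB sumr_const card_ord natz.
by move=> i _; rewrite -natr_neq0_sgnF2 inE; case: (_ != _).
Qed.

End SignCharacter.

(** * Additivity of the trace and orthogonality of additive characters *)

Section Trace.
Local Open Scope ring_scope.
Variables (K : finFieldType) (n : nat).
Hypothesis cardK : #|K| = (2 ^ n)%N.

Let ch2 : 2 \in [pchar K]. Proof. exact: (card_finPcharP cardK). Qed.

Lemma frob_traceD (x y : K) :
  frob_trace n (x + y) = frob_trace n x + frob_trace n y.
Proof.
rewrite /frob_trace -big_split; apply: eq_bigr => i _ /=.
by rewrite exprDn_pchar // pnatX pnatE ?ch2.
Qed.

Lemma abs_traceD (x y : K) :
  abs_trace n (x + y) = abs_trace n x + abs_trace n y.
Proof.
have := frob_traceD x y; rewrite -!(abs_traceE _ cardK).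
have := pcharf0 ch2; rewrite mulr2n => e2.
(* Of the eight bit patterns, the wrong ones turn additivity in [K] into [1 = 0]. *)
case: (F2_cases (abs_trace n x)) => ->; case: (F2_cases (abs_trace n y)) => ->;
  case: (F2_cases (abs_trace n (x + y))) => -> /=;
  rewrite ?mulr1n ?mulr0n ?addr0 ?add0r ?e2 => /eqP;
  rewrite 1?eq_sym ?oner_eq0 1?eq_sym ?oner_eq0 // => _; exact/val_inj.
Qed.

Lemma abs_trace0 : abs_trace n (0 : K) = 0.
Proof.
have := abs_traceD 0 0; rewrite addr0.
by case: (F2_cases (abs_trace n (0 : K))) => ->.
Qed.

(* The trace is a nonzero polynomial of degree 2^(n-1), too small to vanish
   on all of K. *)
Lemma abs_trace_neq0 : exists x : K, abs_trace n x != 0.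
Proof.
have n0 : (0 < n)%N.
  by case: n cardK => // h; move: (finRing_gt1 K); rewrite h.
case: (pickP (fun x : K => abs_trace n x != 0)) => [x ?|z]; first by exists x.
pose p : {poly K} := \sum_(i < n) 'X^(2 ^ i).
have sp : size p = (2 ^ n.-1).+1.
  rewrite /p; case: n n0 => // k _; rewrite big_ord_recr /= addrC.
  rewrite size_polyDl ?size_polyXn // ltnS.
  apply: (leq_trans (size_sum _ _ _)); apply/bigmax_leqP => i _.
  by rewrite size_polyXn ltn_exp2l.
have p0 : p != 0 by rewrite -size_poly_eq0 sp.
(* If all of [K] were roots of [p], then [2 ^ n < 2 ^ n.-1 + 1], which fails. *)
have := max_poly_roots p0 _ (enum_uniq K).
suff rts : all (root p) (enum K).
  move=> /(_ rts); rewrite -cardE cardK sp ltnS leqNgt.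
  by rewrite ltn_exp2l // prednK // leqnn.
apply/allP => x _; rewrite /root /p horner_sum.
under eq_bigr do rewrite hornerXn.
have := abs_traceE x cardK; rewrite /frob_trace => <-.
by move/negbFE/eqP: (z x) => ->.
Qed.

(** For [z != 0], translating [b] by [y / z] with [y] of trace 1 flips every sign, so the sum equals
    its opposite. *)
Lemma sum_sgn_trace (z : K) :
  \sum_(b : K) sgnF2 (abs_trace n (b * z)) = (2 ^ n)%N%:Z * (z == 0)%:R.
Proof.
have [->|z0] := eqVneq.
  under eq_bigr do rewrite mulr0 abs_trace0.
  by rewrite sumr_const cardK mulr1 natz.
rewrite mulr0; have [y ty] := abs_trace_neq0.
set S := \sum_b _.
have : S = - S; last by lia.
rewrite {1}/S (reindex_inj (addIr (y / z))) /= /S -sumrN.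
apply: eq_bigr => b _; rewrite mulrDl divfK // abs_traceD sgnF2D.
by move: ty; case: (F2_cases (abs_trace n y)) => -> // _; rewrite mulrN1.
Qed.

End Trace.

(** * Walsh transform and Fourier inversion *)

Section Walsh.
Local Open Scope ring_scope.
Variables (K : finFieldType) (m : nat).
Hypothesis cardK : #|K| = (2 ^ (2 * m))%N.

Lemma walsh_sgnE (f : K -> 'F_2) (w : K) :
  walsh m f w = \sum_x sgnF2 (f x) * sgnF2 (abs_trace (2 * m) (w * x)).
Proof. by apply: eq_bigr => x _; rewrite -sgnF2D. Qed.

(** After exchanging the sums, the inner sum over [b] has the character of [y + x]; in
    characteristic 2 this vanishes only at [y = x], so only the diagonal survives. *)
Lemma walsh_inversion (f : K -> 'F_2) (x : K) :
  \sum_b walsh m f b * sgnF2 (f x + abs_trace (2 * m) (b * x)) =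
  (2 ^ (2 * m))%N%:Z.
Proof.
under eq_bigr do rewrite walsh_sgnE mulr_suml.
rewrite exchange_big /= (bigD1 x) //= [X in _ + X]big1 ?addr0 => [|y yx].
  under eq_bigr do rewrite sgnF2D mulrACA !sgnF2_sqr.
  by rewrite sumr_const cardK mulr1 natz.
under eq_bigr do rewrite sgnF2D mulrACA -[X in _ * X]sgnF2D -abs_traceD //
  -mulrDr.
rewrite -mulr_sumr sum_sgn_trace // addr_eq0.
have ch2 : 2 \in [pchar K] by apply: (card_finPcharP cardK).
by rewrite oppr_pchar2 // (negbTE yx) !mulr0.
Qed.

Lemma walsh0 (w : K) :
  walsh m (fun=> 0) w = (2 ^ (2 * m))%N%:Z * (w == 0)%:R.
Proof.
rewrite walsh_sgnE -sum_sgn_trace //; apply: eq_bigr => x _.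
by rewrite mul1r mulrC.
Qed.

End Walsh.

(** * Parametrisation of the codewords and their weights *)

Section BentCodewords.
Local Open Scope ring_scope.
Variables (m l : nat) (K : finFieldType) (u : 'I_(2 ^ (2 * m)) -> K).
Variable F : K -> 'rV['F_2]_l.
Hypothesis cardK : #|K| = (2 ^ (2 * m))%N.
Hypothesis bij_u : bijective u.

(** Convertible to the function in [bent_vectorial], so bentness applies to it directly. *)
Definition component (a : 'rV['F_2]_l) (x : K) : 'F_2 :=
  \sum_(j < l) a 0 j * coordinate F j x.

(** Triples are taken in the product group, which makes this map additive; injectivity then reduces
    to a trivial kernel. *)
Definition codeword (t : 'rV['F_2]_l * K * 'F_2) : 'rV['F_2]_(2 ^ (2 * m)) :=
  \row_i (component t.1.1 (u i) + abs_trace (2 * m) (t.1.2 * u i) + t.2).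

Lemma componentD a b x : component (a + b) x = component a x + component b x.
Proof.
by rewrite -big_split; apply: eq_bigr => j _; rewrite mxE mulrDl.
Qed.

Lemma component0 x : component 0 x = 0.
Proof. by apply: big1 => j _; rewrite mxE mul0r. Qed.

Lemma component_delta j x : component (delta_mx 0 j) x = coordinate F j x.
Proof.
rewrite /component (bigD1 j) //= big1 ?addr0 ?mxE ?eqxx ?mul1r // => i ij.
by rewrite mxE (negbTE ij) andbF mul0r.
Qed.

Lemma codewordD s t : codeword (s + t) = codeword s + codeword t.
Proof.
apply/rowP => i; rewrite !mxE /= componentD mulrDl abs_traceD //.
by rewrite [RHS]addrACA [X in _ = X + _]addrACA.
Qed.

Lemma codeword0 : codeword 0 = 0.
Proof. by apply/rowP => i; rewrite !mxE component0 mul0r abs_trace0 // !addr0. Qed.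

Lemma mem_bent_code v : reflect (exists t, v = codeword t) (v \in bent_code u F).
Proof.
apply: (iffP idP) => [|[[[a b] c] ->]].
  apply: (span_closed_mem (P := fun v => exists t, v = codeword t)).
  - by exists 0; rewrite codeword0.
  - by move=> _ _ [s ->] [t ->]; exists (s + t); rewrite codewordD.
  - move=> k _ [t ->]; case: (F2_cases k) => ->.
      by exists 0; rewrite scale0r codeword0.
    by exists t; rewrite scale1r.
  (* Generators: affine words have [a = 0], and the truth table of coordinate [j] has [a] the [j]-th
     unit vector and [b = c = 0]. *)
  move=> w; rewrite mem_cat => /orP[|/mapP[j _ ->]].
    rewrite mem_enum => /imset2P[b c _ _ ->]; exists (0, b, c).
    by apply/rowP => i; rewrite !mxE component0 add0r.
  exists (delta_mx 0 j, 0, 0); apply/rowP => i.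
  by rewrite !mxE component_delta mul0r abs_trace0 // !addr0.
have -> : codeword (a, b, c) =
    \row_i (abs_trace (2 * m) (b * u i) + c) +
    \sum_(j < l) a 0 j *: truth_table u (coordinate F j).
  apply/rowP => i; rewrite !mxE summxE /= -addrA addrC; congr (_ + _).
  by apply: eq_bigr => j _; rewrite !mxE.
apply: rpredD.
  by apply: memv_span; rewrite mem_cat mem_enum imset2_f.
apply: rpred_sum => j _; apply/rpredZ/memv_span.
by rewrite mem_cat orbC map_f // mem_enum.
Qed.

Lemma codeword_wt a b c :
  (hamming_wt (codeword (a, b, c)))%:Z * 2 =
  (2 ^ (2 * m))%N%:Z - sgnF2 c * walsh m (component a) b.
Proof.
rewrite hamming_wt_sgn; congr (_ - _); rewrite /walsh mulr_sumr.
rewrite (reindex u) /=; last exact: onW_bij.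
by apply: eq_bigr => i _; rewrite mxE sgnF2D mulrC.
Qed.

Lemma codeword_wt0 b c :
  (hamming_wt (codeword (0, b, c)))%:Z * 2 =
  (2 ^ (2 * m))%N%:Z * (1 - sgnF2 c * (b == 0)%:R).
Proof.
rewrite codeword_wt mulrBr mulr1; congr (_ - _).
rewrite mulrCA -(walsh0 cardK); congr (_ * _).
by apply: eq_bigr => x _; rewrite component0.
Qed.

End BentCodewords.

(** * Weights, dimension and block counts for a bent function *)

Section BentDesign.
Local Open Scope ring_scope.
Variables (m l : nat) (K : finFieldType) (u : 'I_(2 ^ (2 * m)) -> K).
Variable F : K -> 'rV['F_2]_l.
Hypothesis cardK : #|K| = (2 ^ (2 * m))%N.
Hypothesis bij_u : bijective u.
Hypothesis m_ge2 : (2 <= m)%N.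
Hypothesis bentF : bent_vectorial m F.

(** Half the absolute value of the Walsh transform of a bent function; all parameters become
    polynomials in [M], free of truncated exponents. *)
Let M := (2 ^ (m - 1))%N.

Let expm : (2 ^ m = 2 * M)%N.
Proof. by rewrite /M -expnS; congr (2 ^ _)%N; lia. Qed.

Let exp2m : (2 ^ (2 * m) = 4 * (M * M))%N.
Proof. by rewrite mul2n -addnn expnD expm; lia. Qed.

Let exp2mZ : (2 ^ (2 * m))%N%:Z = M%:Z * M%:Z * 4.
Proof. by rewrite exp2m; lia. Qed.

Let M_ge2 : (2 <= M)%N.
Proof. by rewrite -[X in (X <= _)%N]expn1 leq_exp2l //; lia. Qed.

Lemma walsh_component a b : a != 0 ->
  walsh m (component F a) b = M%:Z * 2 \/ walsh m (component F a) b = - (M%:Z * 2).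
Proof.
move=> a0; have : `|walsh m (component F a) b| = _ := bentF a0 b.
by rewrite expm; lia.
Qed.

(** The sign [e] selects the weight: [1] the smaller, [-1] the larger, so both designs are treated
    at once. *)
Lemma codeword_wt_eq (e : int) (k : nat) a b c :
  e = 1 \/ e = -1 -> k%:Z = M%:Z * M%:Z * 2 - e * M%:Z ->
  (hamming_wt (codeword u F (a, b, c)) == k) =
  (a != 0) && (sgnF2 c * walsh m (component F a) b == e * (M%:Z * 2)).
Proof.
move=> he hk; have [->|a0] /= := eqVneq a 0.
  (* For [a = 0] the doubled weight is 0, [4M^2] or [8M^2], never [2k = 4M^2 - 2eM], which lies
     strictly between two of these. *)
  have := codeword_wt0 F cardK bij_u b c; rewrite exp2mZ => hw.
  apply/eqP => wk; move: hw; rewrite wk hk.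
  case: (F2_cases c) => ->; case: (b == 0); case: he => ->;
  rewrite /sgnF2 /= ?expr0 ?expr1; nia.
have := codeword_wt F bij_u a b c; rewrite exp2mZ => hw.
apply/eqP/eqP; lia.
Qed.

(** Read off from the weight: [a != 0] gives a doubled weight of at least [4M^2 - 2M > 0], and for
    [a = 0] weight 0 forces [b = 0] and [c = 0]. *)
Lemma codeword_eq0 t : codeword u F t = 0 -> t = 0.
Proof.
case: t => [[a b] c] t0.
have wt0 : hamming_wt (codeword u F (a, b, c)) = 0%N.
  by rewrite t0; apply: eq_card0 => i; rewrite !inE mxE eqxx.
have a0 : a = 0.
  apply/eqP/negPn/negP => a0.
  have := codeword_wt F bij_u a b c; rewrite wt0 exp2mZ.
  by case: (walsh_component b a0) => ->; case: (F2_cases c) => ->;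
    rewrite /sgnF2 /= ?expr0 ?expr1; nia.
move: wt0; rewrite a0 => wt0.
have := codeword_wt0 F cardK bij_u b c; rewrite wt0 exp2mZ.
case: (F2_cases c) => ->; have [-> //|_] := eqVneq b 0;
rewrite /sgnF2 /= ?expr0 ?expr1; nia.
Qed.

Lemma codeword_inj : injective (codeword u F).
Proof.
move=> s t st; apply/eqP; rewrite -subr_eq0; apply/eqP/codeword_eq0.
by apply: (addIr (codeword u F t)); rewrite -codewordD // subrK add0r.
Qed.

(** By injectivity the code has as many words as there are triples, and its cardinality is 2 to its
    dimension. *)
Lemma bent_code_dim : \dim (bent_code u F) = (2 * m + 1 + l)%N.
Proof.
have : #|bent_code u F| = (2 ^ (2 * m + 1 + l))%N.
  have -> : #|bent_code u F| = #|[set codeword u F t | t : _]|.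
    apply: eq_card => v; apply/mem_bent_code/imsetP => //.
      by case=> t ->; exists t.
    by case=> t _ ->; exists t.
  rewrite card_imset; last exact: codeword_inj.
  rewrite !card_prod card_mx cardK card_Fp // mul1n.
  by rewrite [RHS]expnD [(2 ^ (_ + 1))%N]expnD -mulnA mulnC.
by rewrite card_vspace card_Fp // => /eqP; rewrite eqn_exp2l // => /eqP.
Qed.

Lemma codeword_min_wt (k : nat) t :
  k%:Z = M%:Z * M%:Z * 2 - M%:Z -> t != 0 ->
  (k <= hamming_wt (codeword u F t))%N.
Proof.
case: t => [[a b] c] hk t0; set w := hamming_wt _.
have [a0|a0] := eqVneq a 0.
  have : w%:Z * 2 = (2 ^ (2 * m))%N%:Z * (1 - sgnF2 c * (b == 0)%:R).
    by rewrite /w a0; exact: codeword_wt0.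
  rewrite exp2mZ; case: (F2_cases c) => c0; have [b0|_] := eqVneq b 0;
    first (by case/eqP: t0; rewrite a0 b0 c0);
  rewrite c0 /sgnF2 /= ?expr0 ?expr1; nia.
have : w%:Z * 2 = _ := codeword_wt F bij_u a b c; rewrite exp2mZ.
by case: (walsh_component b a0) => ->; case: (F2_cases c) => ->;
  rewrite /sgnF2 /= ?expr0 ?expr1; nia.
Qed.

Lemma bent_code_linear (k : nat) : (0 < l)%N ->
  k%:Z = M%:Z * M%:Z * 2 - M%:Z ->
  is_linear_code (2 * m + 1 + l) k (bent_code u F).
Proof.
move=> l0 hk; split; first exact: bent_code_dim.
  have [a a0] : exists a : 'rV['F_2]_l, a != 0.
    exists (const_mx 1); apply/eqP => /rowP/(_ (Ordinal l0)).
    by rewrite !mxE => /eqP; rewrite oner_eq0.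
  (* The constant [c] is chosen to make the signed Walsh value positive, which gives the smaller
     weight. *)
  have [c hc] : exists c, sgnF2 c * walsh m (component F a) 0 = 1 * (M%:Z * 2).
    case: (walsh_component 0 a0) => ->.
      by exists 0; rewrite /sgnF2.
    by exists 1; rewrite /sgnF2 mulN1r opprK mul1r.
  exists (codeword u F (a, 0, c)), 0; rewrite hamming_dist_wt subr0; split.
  - by apply/(mem_bent_code u F cardK); exists (a, 0, c).
  - exact: rpred0.
  - apply/eqP => /codeword_eq0[] a0'; by rewrite a0' eqxx in a0.
  - apply/eqP; rewrite (@codeword_wt_eq 1) ?a0 ?hc ?eqxx //; first by left.
    by rewrite mul1r.
move=> _ _ /(mem_bent_code u F cardK)[s ->] /(mem_bent_code u F cardK)[t ->] st.
rewrite hamming_dist_wt.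
have -> : codeword u F s - codeword u F t = codeword u F (s - t).
  by apply/eqP; rewrite subr_eq -codewordD // subrK.
apply: codeword_min_wt => //; rewrite subr_eq0.
by apply: contraNneq st => ->.
Qed.

(* [2M + e (-1)^c W(b)] is [4M] times the indicator of the chosen weight, and
   [1 - (-1)^c h x] twice the indicator of [x] being in the support; summing the
   product over [c] and [b] leaves only character sums. *)
Lemma count_component_blocks (e : int) a (x y : K) :
  e = 1 \/ e = -1 -> a != 0 -> x != y ->
  \sum_(b : K) \sum_(c : 'F_2)
    ((sgnF2 c * walsh m (component F a) b == e * (M%:Z * 2)) &&
     (component F a x + abs_trace (2 * m) (b * x) + c != 0%R) &&
     (component F a y + abs_trace (2 * m) (b * y) + c != 0%R))%:R
  = M%:Z * M%:Z - e * M%:Z.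
Proof.
move=> he a0 xy.
pose h z b : int := sgnF2 (component F a z + abs_trace (2 * m) (b * z)).
pose W b := walsh m (component F a) b.
(* The factor is [4M * 2 * 2], one scaling for each of the three indicators. *)
have M0 : M%:Z * 16 != 0 by lia.
apply: (mulIf M0); rewrite mulr_suml.
(* Summing over [c] cancels the terms odd in [sgnF2 c] and doubles the even ones. *)
rewrite (eq_bigr (fun b => M%:Z * 4 + M%:Z * 4 * (h x b * h y b)
    - e * 2 * (W b * h x b) - e * 2 * (W b * h y b))); last first.
  move=> b _; rewrite mulr_suml sum_F2.
  have E c : ((sgnF2 c * walsh m (component F a) b == e * (M%:Z * 2)) &&
     (component F a x + abs_trace (2 * m) (b * x) + c != 0%R) &&
     (component F a y + abs_trace (2 * m) (b * y) + c != 0%R))%:R * (M%:Z * 16)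
     = (M%:Z * 2 + e * (sgnF2 c * W b)) * (1 - h x b * sgnF2 c)
       * (1 - h y b * sgnF2 c).
    rewrite -!sgnF2D -!natr_neq0_sgnF2 -!mulnb !natrM.
    have -> : M%:Z * 2 + e * (sgnF2 c * W b) =
        (sgnF2 c * W b == e * (M%:Z * 2))%:R * (M%:Z * 4).
      rewrite /W; case: (walsh_component b a0) => ->; case: he => ->;
      case: (F2_cases c) => ->; rewrite /sgnF2 /= ?expr0 ?expr1; lia.
    rewrite /W; ring.
  rewrite !E /sgnF2 /= expr0 expr1.
  ring.
have Exy : \sum_b h x b * h y b = 0.
  under eq_bigr => b _.
    rewrite /h !sgnF2D mulrACA -[X in _ * X]sgnF2D -abs_traceD // -mulrDr.
    over.
  rewrite -mulr_sumr sum_sgn_trace // addr_eq0.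
  have ch2 : 2 \in [pchar K] by apply: (card_finPcharP cardK).
  by rewrite oppr_pchar2 // (negbTE xy) !mulr0.
rewrite !sumrB big_split /= -!mulr_sumr Exy.
(* What remains is [16M^3 - 16eM^2], that is [16M] times the claimed count. *)
rewrite !(walsh_inversion cardK) sumr_const cardK -mulr_natr natz exp2mZ.
 case: he => ->; lia.
Qed.

Lemma bent_code_design (e : int) (k lam : nat) :
  e = 1 \/ e = -1 -> k%:Z = M%:Z * M%:Z * 2 - e * M%:Z ->
  lam%:Z = M%:Z * M%:Z - e * M%:Z ->
  is_2design (2 ^ (2 * m)) k ((2 ^ l - 1) * lam)
    (supports_of_weight (bent_code u F) k).
Proof.
move=> he hk hlam; split; first by rewrite card_ord.
  by move=> B /imsetP[c]; rewrite inE => /andP[_ /eqP <-] ->.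
move=> P /eqP/cards2P[i [j [ij ->]]].
pose A := [set t | (hamming_wt (codeword u F t) == k) &&
  ([set i; j] \subset csupp (codeword u F t))].
(* A binary word is determined by its support and a codeword by its triple, so counting blocks
   amounts to counting triples. *)
have -> : [set B in supports_of_weight (bent_code u F) k | [set i; j] \subset B]
    = [set csupp (codeword u F t) | t in A].
  apply/setP => B; rewrite inE; apply/andP/imsetP.
    case=> /imsetP[c]; rewrite inE => /andP[/(mem_bent_code u F cardK)[t ->] wt ->].
    by move=> sub; exists t; rewrite // inE wt.
  case=> t; rewrite inE => /andP[wt sub] ->; split=> //.
  by apply: imset_f; rewrite inE wt andbT; apply/(mem_bent_code u F cardK); exists t.
rewrite card_imset; last by move=> s t /csupp_inj/codeword_inj.
suff : #|A|%:Z = ((2 ^ l - 1) * lam)%N%:Z by case.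
rewrite -sum1_card big_mkcond /= -natz natr_sum.
pose G (a : 'rV['F_2]_l) (b : K) (c : 'F_2) : int :=
  ((sgnF2 c * walsh m (component F a) b == e * (M%:Z * 2)) &&
     (component F a (u i) + abs_trace (2 * m) (b * u i) + c != 0%R) &&
     (component F a (u j) + abs_trace (2 * m) (b * u j) + c != 0%R))%:R.
rewrite (eq_bigr (fun t => if t.1.1 != 0 then G t.1.1 t.1.2 t.2 else 0)).
  rewrite -(pair_bigA _ (fun ab c => if ab.1 != 0 then G ab.1 ab.2 c else 0)) /=.
  rewrite -(pair_bigA _ (fun a b => \sum_c if a != 0 then G a b c else 0)) /=.
  (* No triple with [a = 0] has the chosen weight; each of the [2 ^ l - 1] other values of [a]
     contributes [lam]. *)
  rewrite (bigD1 0) //= [X in X + _]big1 ?add0r; last first.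
    by move=> b _; apply: big1 => c _; rewrite eqxx.
  rewrite (eq_bigr (fun=> lam%:Z)) => [|a a0].
    rewrite sumr_const.
    have -> : #|(fun a : 'rV['F_2]_l => a != 0)| = (2 ^ l - 1)%N.
      rewrite cardC1 card_mx card_Fp // mul1n; lia.
    by rewrite -mulr_natr natz -PoszM mulnC.
  rewrite hlam -(count_component_blocks he a0 (x := u i) (y := u j)).
    by apply: eq_bigr => b _; apply: eq_bigr => c _; rewrite a0.
  by rewrite (inj_eq (bij_inj bij_u)).
move=> [[a b] c] _; rewrite inE (codeword_wt_eq _ _ _ he hk) /=.
rewrite subUset !sub1set !inE !mxE /= /G.
by case: (a != 0) => //=; rewrite andbA; case: (_ && _).
Qed.

End BentDesign.

Theorem theorem11 (m l : nat) (K : finFieldType) (u : 'I_(2 ^ (2 * m)) -> K)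
    (F : K -> 'rV['F_2]_l) :
  #|K| = 2 ^ (2 * m) -> bijective u ->
  2 <= m -> 1 <= l <= m ->
  bent_vectorial m F ->
  [/\ is_linear_code (2 * m + 1 + l) (2 ^ (2 * m - 1) - 2 ^ (m - 1))
        (bent_code u F),
      is_2design (2 ^ (2 * m)) (2 ^ (2 * m - 1) - 2 ^ (m - 1))
        ((2 ^ l - 1) * (2 ^ (2 * m - 2) - 2 ^ (m - 1)))
        (supports_of_weight (bent_code u F) (2 ^ (2 * m - 1) - 2 ^ (m - 1)))
    & is_2design (2 ^ (2 * m)) (2 ^ (2 * m - 1) + 2 ^ (m - 1))
        ((2 ^ l - 1) * (2 ^ (2 * m - 2) + 2 ^ (m - 1)))
        (supports_of_weight (bent_code u F) (2 ^ (2 * m - 1) + 2 ^ (m - 1)))].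
Proof.
move=> cardK bij_u m2 /andP[l1 _] bentF.
(* The stated parameters are rewritten in terms of [2 ^ (m - 1)], so that the truncated subtractions
   are settled by arithmetic. *)
have E1 : 2 ^ (2 * m - 1) = 2 * (2 ^ (m - 1) * 2 ^ (m - 1)).
  by rewrite -expnD -expnS; congr (2 ^ _); lia.
have E2 : 2 ^ (2 * m - 2) = 2 ^ (m - 1) * 2 ^ (m - 1).
  by rewrite -expnD; congr (2 ^ _); lia.
have M0 : 0 < 2 ^ (m - 1) by rewrite expn_gt0.
split.
- by apply: bent_code_linear => //; rewrite E1; nia.
- by apply: (@bent_code_design _ _ _ u F _ _ _ _ 1%R) => //; rewrite ?E1 ?E2; [left|nia|nia].
- by apply: (@bent_code_design _ _ _ u F _ _ _ _ (-1)%R) => //; rewrite ?E1 ?E2; [right|nia|nia].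
Qed.
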